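(* Let $G$ be a finite group. Then the Dirichlet polynomial $P_G(s)$ can be determined from the knowledge of $\Lambda^*(G)$; that is, if $G$ and $H$ are finite groups with $\Lambda^*(G)=\Lambda^*(H)$, then $P_G(s)=P_H(s)$.
   Context: For a finite group $G$, the Möbius function $\mu_G$ on the subgroup lattice of $G$ is defined by $\sum_{K\geq H}\mu_G(K)=\delta_{H,G}$ for every $H\leq G$, where $\delta_{G,G}=1$ and $\delta_{H,G}=0$ if $H\neq G$. The Dirichlet polynomial of $G$ is $$P_G(s)=\sum_{n\in\mathbb N}\frac{a_n(G)}{n^s},\qquad a_n(G)=\sum_{|G:H|=n}\mu_G(H),$$ with $s$ a complex variable; for $t\in\mathbb N$, $P_G(t)$ is the probability that $t$ randomly chosen elements generate $G$. For non-negative integers $a\leq b$, $\Gamma_{a,b}(G)$ is the undirected graph, possibly with loops, whose vertices are the elements of $G^a\cup G^b$ (a disjoint union if $a\neq b$, just $G^a$ if $a=b$; $G^0$ consists of the single empty tuple), in which $(x_1,\dots,x_a)\in G^a$ and $(y_1,\dots,y_b)\in G^b$ are adjacent if and only if $\langle x_1,\dots,x_a,y_1,\dots,y_b\rangle=G$. If $a\neq b$ there are no other edges; if $a=b$ there is a loop at $x\in G^a$ exactly when the entries of $x$ generate $G$. A vertex is isolated if it is adjacent to no vertex (itself included). $\Gamma^*_{a,b}(G)$ is obtained from $\Gamma_{a,b}(G)$ by deleting the isolated vertices. $\Lambda^*(G)$ is the collection of all the connected components of the graphs $\Gamma^*_{a,b}(G)$, for all non-negative integers $a\leq b$, regarded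 as abstract graphs (with their loops) up to isomorphism and counted with multiplicity; the labels $a,b$ from which each graph arises are not part of the data. Thus $\Lambda^*(G)=\Lambda^*(H)$ means that there is a bijection between the two collections matching isomorphic graphs. *)

(* Defs.v *)
From mathcomp Require Import all_boot all_order all_fingroup all_algebra.
From mathcomp Require Import complex.
From mathcomp Require Import reals sequences exp trigo.

Set Implicit Arguments.
Unset Strict Implicit.
Unset Printing Implicit Defensive.

Import GRing.Theory Num.Theory.
Local Open Scope ring_scope.

(* The defining identity \sum_(K >= H) mu(K) = delta(H, G) is solved by
   downward recursion on H; k bounds the length of the chains from H to G, and
   #|G| is always enough (see mobiusP). *)
Fixpoint mobius_rec (gT : finGroupType) (G : {group gT}) (k : nat)
    (H : {group gT}) : int :=
  (H == G)%:R -
  (if k is k'.+1 then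
     \sum_(K : {group gT} | (H \proper K) && (K \subset G)) mobius_rec G k' K
   else 0).

Definition mobius (gT : finGroupType) (G H : {group gT}) : int :=
  mobius_rec G #|G| H.

Lemma mobius_rec_eq (gT : finGroupType) (G : {group gT}) (k l : nat)
    (H : {group gT}) :
  (#|G| - #|H| <= k)%N -> (#|G| - #|H| <= l)%N ->
  mobius_rec G k H = mobius_rec G l H.
Proof.
elim: k l H => [|k IH] [|l] H //= lek lel; congr (_ - _).
- rewrite big1 // => K /andP[HK KG]; have := proper_card HK.
  have := subset_leq_card KG; rewrite leqn0 subn_eq0 in lek => le1 lt1.
  by have := leq_trans lt1 (leq_trans le1 lek); rewrite ltnn.
- rewrite big1 // => K /andP[HK KG]; have := proper_card HK.
  have := subset_leq_card KG; rewrite leqn0 subn_eq0 in lel => le1 lt1.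
  by have := leq_trans lt1 (leq_trans le1 lel); rewrite ltnn.
- apply: eq_bigr => K /andP[HK KG].
  have dec : (#|G| - #|K| < #|G| - #|H|)%N.
    apply: ltn_sub2l (proper_card HK).
    exact: leq_trans (proper_card HK) (subset_leq_card KG).
  by apply: IH; rewrite -ltnS (leq_trans dec).
Qed.

Lemma mobiusP (gT : finGroupType) (G H : {group gT}) : H \subset G ->
  \sum_(K : {group gT} | (H \subset K) && (K \subset G)) mobius G K
    = (H == G)%:R.
Proof.
move=> HG; rewrite (bigD1 H) ?subxx //=.
have -> : mobius G H = mobius_rec G #|G|.+1 H.
  by apply: mobius_rec_eq; rewrite ?leqW ?leq_subr.
rewrite [X in X + _]/=.
rewrite [X in _ + X](eq_bigl
  (fun K : {group gT} => (H \proper K) && (K \subset G))) ?subrK //.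
by move=> K; rewrite properEneq eq_sym -val_eqE /= andbC andbA.
Qed.

Definition dirichlet_coef (gT : finGroupType) (G : {group gT}) (n : nat) : int :=
  \sum_(H : {group gT} | (H \subset G) && (#|G : H|%g == n)) mobius G H.

Lemma dirichlet_coef_eq0 (gT : finGroupType) (G : {group gT}) (n : nat) :
  (#|G| < n)%N -> dirichlet_coef G n = 0.
Proof.
move=> ltGn; apply: big_pred0 => H; apply/negP => /andP[HG /eqP idx].
by move: ltGn; rewrite -idx ltnNge dvdn_leq ?cardG_gt0 ?dvdn_indexg.
Qed.

(* n ^ s = exp (s log n), for n > 0. *)
Definition natcpow (R : realType) (n : nat) (s : complex R) : complex R :=
  let t := ln n%:R in
  Complex (expR (complex.Re s * t) * cos (complex.Im s * t))
          (expR (complex.Re s * t) * sin (complex.Im s * t)).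

Lemma natcpow_nat (R : realType) (n t : nat) : (0 < n)%N ->
  natcpow n t%:R = n%:R ^+ t :> complex R.
Proof.
move=> n0; have -> : t%:R = Complex t%:R 0 :> complex R.
  by rewrite -(rmorph_nat (real_complex R)).
rewrite /natcpow /= mul0r cos0 sin0 mulr0 mulr1.
rewrite expRM_natl lnK ?posrE ?ltr0n //.
by rewrite -(rmorph_nat (real_complex R) n) -(rmorphXn (real_complex R)).
Qed.

(* Truncating the sum over all n at #|G| is harmless by dirichlet_coef_eq0. *)
Definition dirichlet_poly (R : realType) (gT : finGroupType) (G : {group gT})
    (s : complex R) : complex R :=
  \sum_(1 <= n < #|G|.+1) (dirichlet_coef G n)%:~R / natcpow n s.

(* Finite undirected graphs in which loops are allowed. *)
Record lgraph := LGraph {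
  vertex :> finType;
  adj : rel vertex;
  adj_sym : symmetric adj
}.

Definition graph_iso (A B : lgraph) : Prop :=
  exists2 f : A -> B, bijective f & forall x y, adj (f x) (f y) = adj x y.

Definition induced (A : lgraph) (S : {set A}) : lgraph :=
  @LGraph {x : A | x \in S} (fun x y => adj (val x) (val y))
    (fun x y => adj_sym (val x) (val y)).

Definition isolated_vertex (A : lgraph) (x : A) : bool := [forall y, ~~ adj x y].

Definition delete_isolated (A : lgraph) : lgraph :=
  induced [set x : A | ~~ isolated_vertex x].

Definition components (A : lgraph) : {set {set A}} :=
  equivalence_partition (connect (@adj A)) [set: A].

(* G^a `union` G^b is realised, for a <= b, inside the sequences of length at
   most b: tuples of different lengths are different sequences, so the union is
   disjoint if a <> b and is just G^a if a = b. *)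
Definition gen_vertex (gT : finGroupType) (G : {group gT}) (a b : nat) :
    pred (b.-bseq gT) :=
  fun x => ((size x == a) || (size x == b)) && all [in G] x.

Definition gen_adj (gT : finGroupType) (G : {group gT}) (a b : nat) :
    rel {x : b.-bseq gT | gen_vertex G a x} :=
  fun x y =>
    [|| (size (val x) == a) && (size (val y) == b)
      | (size (val x) == b) && (size (val y) == a)]
    && (<<[set:: val x ++ val y]>>%g == G :> {set gT}).

Lemma gen_adj_sym (gT : finGroupType) (G : {group gT}) (a b : nat) :
  symmetric (@gen_adj gT G a b).
Proof.
move=> x y; rewrite /gen_adj orbC ![(size (val y) == _) && _]andbC.
congr (_ && (<<_>>%g == _)).
by apply/setP => z; rewrite !inE !mem_cat orbC.
Qed.

Definition gen_graph (gT : finGroupType) (G : {group gT}) (a b : nat) : lgraph :=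
  LGraph (@gen_adj_sym gT G a b).

Definition gen_graph_star (gT : finGroupType) (G : {group gT}) (a b : nat) :
    lgraph :=
  delete_isolated (gen_graph G a b).

Record Lambda_index (gT : finGroupType) (G : {group gT}) := LambdaIndex {
  la : nat;
  lb : nat;
  la_le_lb : (la <= lb)%N;
  lcomp : {set gen_graph_star G la lb};
  lcompP : lcomp \in components (gen_graph_star G la lb)
}.

(* Lambda^*(G), as a family of graphs; the index is not part of the data. *)
Definition Lambda_star (gT : finGroupType) (G : {group gT})
    (i : Lambda_index G) : lgraph :=
  induced (lcomp i).

(* Lambda^*(G) = Lambda^*(H), as collections of isomorphism classes counted
   with multiplicity. *)
Definition same_Lambda_star (gT hT : finGroupType) (G : {group gT})
    (H : {group hT}) : Prop :=
  exists2 f : Lambda_index G -> Lambda_index H,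
    bijective f & forall i, graph_iso (Lambda_star i) (Lambda_star (f i)).

(* Main.v *)
Require Import Defs.
From mathcomp Require Import all_boot all_order all_fingroup all_algebra.
From mathcomp Require Import complex reals.

Set Implicit Arguments.
Unset Strict Implicit.
Unset Printing Implicit Defensive.

Import GRing.Theory Num.Theory.
Local Open Scope ring_scope.

(** Write phi_b(G) for the number of b-tuples that generate G.  In the graph
    Gamma_(0,b) with b > 0 the non-isolated vertices are the empty tuple and the
    generating b-tuples, and the edges join the former to each of the latter:
    the graph without its isolated vertices is a star with phi_b(G) leaves.  No
    other component gives a star with a new number of leaves
    ([num_gen_of_star]): if 0 < a and x, y are adjacent, then so are y and the
    tuple obtained from x by multiplying one entry by an entry of y, which is a
    second neighbour of y unless y is a tuple of identities.  So the leaves of a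
    star with 0 < a are tuples of identities, its centre generates G, hence is
    adjacent to all tuples over G of the length of the leaves, and G is trivial.
    Therefore Lambda^*(G), without its labels, determines the set of the numbers
    phi_b(G) that are nonzero, for b > 0.

    If G is nontrivial, phi_b(G) is strictly increasing from its first nonzero
    value on, so that two groups G and H with the same set satisfy
    phi_(d+i)(G) = phi_(e+i)(H) for some d, e and all i
    ([same_counts_shift]); the starting points d and e are not yet comparable.

    By Moebius inversion, phi_t(G) is the sum over k of c_k(G) k^t, where c_k(G)
    is the sum of mu_G(K) over the subgroups K of order k ([num_genE]).  The
    functions t |-> k^t are linearly independent ([exp_sum_eq0]), so
    c_k(G) k^d = c_k(H) k^e for every k.  The largest k with c_k(G) nonzero is
    |G|, where the coefficient is 1; thus |G| = |H| and |G|^d = |H|^e, which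
    gives d = e unless G is trivial, and c_k(G) = c_k(H) for all k in any case
    ([shifted_num_gen]).  The coefficients of the Dirichlet polynomial are
    a_n(G) = c_(|G|/n)(G), so the two polynomials agree. *)

(** * Counting generating tuples by Moebius inversion *)

Definition gen_tuples (gT : finGroupType) (G : {group gT}) (b : nat) :
    {set b.-tuple gT} :=
  [set x : b.-tuple gT | <<[set:: x]>>%g == G :> {set gT}].

Definition num_gen (gT : finGroupType) (G : {group gT}) (b : nat) : nat :=
  #|gen_tuples G b|.

(** The coefficients are grouped by the order of the subgroup instead of its
    index, so that they are those of an exponential sum in t. *)
Definition order_coef (gT : finGroupType) (G : {group gT}) (k : nat) : int :=
  \sum_(K : {group gT} | (K \subset G) && (#|K| == k)) mobius G K.

Lemma sub_seq_group (gT : finGroupType) (K : {group gT}) (s : seq gT) :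
  (<<[set:: s]>>%g \subset K) = all [in K] s.
Proof.
rewrite gen_subG; apply/subsetP/allP => sK x; last by rewrite inE; apply: sK.
by move=> xs; apply: sK; rewrite inE.
Qed.

Lemma card_tuples_in (T : finType) (A : {pred T}) (b : nat) :
  #|[set x : b.-tuple T | all [in A] x]| = (#|A| ^ b)%N.
Proof.
have inj : injective (fun f : {ffun 'I_b -> T} => [tuple f i | i < b]).
  move=> f g /(congr1 (@tnth _ _)) fg; apply/ffunP => i.
  by rewrite -(tnth_mktuple f) fg tnth_mktuple.
have -> : (#|A| ^ b = #|@ffun_on_mem 'I_b T (mem A)|)%N
  by rewrite card_ffun_on card_ord.
rewrite -(card_image inj).
apply: eq_card => x; rewrite inE; apply/all_tnthP/imageP => [xA | [f fA -> i]].
  exists [ffun i => tnth x i]; first by apply/ffun_onP => i; rewrite ffunE; apply: xA.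
  by apply: eq_from_tnth => i; rewrite tnth_mktuple ffunE.
by rewrite tnth_mktuple; apply/(ffun_onP fA).
Qed.

(** Every tuple x in G^b contributes the sum of mu_G over the subgroups between
    <x> and G, which is 1 or 0 according to whether x generates G; exchanging the
    two sums counts, for each K, the tuples over K. *)
Lemma num_gen_mobius (gT : finGroupType) (G : {group gT}) (b : nat) :
  (num_gen G b)%:Z = \sum_(K : {group gT} | K \subset G) mobius G K * #|K|%:Z ^+ b.
Proof.
have inversion (x : b.-tuple gT) : (x \in gen_tuples G b)%:R =
    \sum_(K : {group gT} | (K \subset G) && all [in K] x) mobius G K.
  rewrite inE; have [xG | xG] := boolP (<<[set:: x]>>%g \subset G).
    rewrite -(mobiusP xG); apply: eq_bigl => K.
    by rewrite -sub_seq_group andbC.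
  rewrite big_pred0 => [|K]; last first.
    apply: contraNF xG => /andP[KG].
    by rewrite -sub_seq_group => /subset_trans; apply.
  by rewrite (negbTE (contraNneq _ xG)) // => ->.
rewrite /num_gen -sum1_card big_mkcond /= -natz natr_sum.
rewrite (eq_bigr _ (fun x _ => inversion x)).
rewrite (exchange_big_dep (fun K : {group gT} => K \subset G)) /=; last by move=> ? ? _ /andP[].
apply: eq_bigr => K KG; rewrite KG /= sumr_const -[#|K|%:Z]natz -natrX -card_tuples_in mulr_natr.
by congr (_ *+ _); apply: eq_card => x; rewrite !inE.
Qed.

Lemma mobius_top (gT : finGroupType) (G : {group gT}) : mobius G G = 1.
Proof.
have := mobiusP (subxx G); rewrite (big_pred1 G) ?eqxx // => K.
by rewrite -eqEsubset eq_sym.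
Qed.

Lemma order_coef_top (gT : finGroupType) (G : {group gT}) :
  order_coef G #|G| = 1.
Proof.
rewrite /order_coef (big_pred1 G) ?mobius_top // => K.
by rewrite -[RHS]val_eqE eqEcard; apply: andb_id2l => KG; rewrite eqn_leq subset_leq_card.
Qed.

Lemma order_coef0 (gT : finGroupType) (G : {group gT}) : order_coef G 0 = 0.
Proof.
by apply: big_pred0 => K; rewrite (gtn_eqF (cardG_gt0 K)) andbF.
Qed.

Lemma order_coef_gt (gT : finGroupType) (G : {group gT}) (k : nat) :
  (#|G| < k)%N -> order_coef G k = 0.
Proof.
move=> ltGk; apply: big_pred0 => K; apply/negP => /andP[/subset_leq_card le /eqP eqk].
by move: ltGk; rewrite -eqk ltnNge le.
Qed.

Lemma num_genE (gT : finGroupType) (G : {group gT}) (N t : nat) :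
  (#|G| < N)%N ->
  (num_gen G t)%:Z = \sum_(k < N) order_coef G k * k%:Z ^+ t.
Proof.
move=> ltGN; rewrite num_gen_mobius.
have ltN (K : {group gT}) : K \subset G -> (#|K| < N)%N.
  by move/subset_leq_card/leq_ltn_trans; apply.
have [N' eqN] : {N' | N = N'.+1} by case: N ltGN {ltN} => // N' _; exists N'.
subst N; rewrite (partition_big (fun K : {group gT} => inord #|K| : 'I_N'.+1) xpredT) //=.
apply: eq_bigr => k _; rewrite /order_coef mulr_suml.
have eqk (K : {group gT}) :
  (K \subset G) && (inord #|K| == k) = (K \subset G) && (#|K| == k).
  by apply: andb_id2l => KG; rewrite -val_eqE /= inordK ?ltN.
by rewrite (eq_bigl _ _ eqk); apply: eq_bigr => K /andP[_ /eqP ->].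
Qed.

Lemma dirichlet_coefE (gT : finGroupType) (G : {group gT}) (n : nat) :
  dirichlet_coef G n = \sum_(k < #|G|.+1 | (k * n == #|G|)%N) order_coef G k.
Proof.
rewrite /dirichlet_coef (partition_big (fun K : {group gT} => inord #|K| : 'I_#|G|.+1)
  (fun k => k * n == #|G|)%N) /= => [|K /andP[KG /eqP <-]]; last first.
  by rewrite inordK ?Lagrange ?ltnS ?subset_leq_card.
apply: eq_bigr => k /eqP kn; apply: eq_bigl => K; rewrite -andbA.
apply: andb_id2l => KG; rewrite -val_eqE /= inordK ?ltnS ?subset_leq_card //.
apply/andb_idl => /eqP Kk; rewrite -(eqn_pmul2l (cardG_gt0 K)).
by rewrite (Lagrange KG) Kk [X in _ == X]kn.
Qed.

(** The relations for all t make the functional p |-> \sum_j c_j p(j) vanish on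
    all polynomials, in particular on the one whose roots are the j <> k. *)
Lemma exp_sum_eq0 (N : nat) (c : nat -> int) :
  (forall t, \sum_(k < N) c k * k%:Z ^+ t = 0) -> forall k, (k < N)%N -> c k = 0.
Proof.
move=> sum0 k ltk.
have eval0 (p : {poly int}) : \sum_(j < N) c j * p.[j%:Z] = 0.
  under eq_bigr do rewrite horner_coef mulr_sumr.
  rewrite exchange_big big1 //= => i _.
  under eq_bigr do rewrite mulrCA.
  by rewrite -mulr_sumr sum0 mulr0.
have := eval0 (\prod_(j < N | j != Ordinal ltk) ('X - (j%:Z)%:P)).
rewrite (bigD1 (Ordinal ltk)) //= [X in _ + X]big1 => [|j neq]; last first.
  by rewrite horner_prod (bigD1 j) //= hornerXsubC subrr mul0r mulr0.
move/eqP; rewrite addr0 mulf_eq0 horner_prod => /orP[/eqP // |].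
case/prodf_eq0 => j neq; rewrite hornerXsubC subr_eq0 => /eqP [eqj].
by case/negP: neq; apply/eqP/val_inj.
Qed.

(** * Recovering the Dirichlet polynomial from shifted counts *)

Lemma shifted_order_coef (gT hT : finGroupType) (G : {group gT}) (H : {group hT})
    (d e : nat) :
  (forall i, num_gen G (d + i) = num_gen H (e + i)) ->
  forall k, order_coef G k * k%:Z ^+ d = order_coef H k * k%:Z ^+ e.
Proof.
move=> eqGH k; apply/eqP; rewrite -subr_eq0; apply/eqP.
apply: (@exp_sum_eq0 (k + #|G| + #|H|).+1 
  (fun k => order_coef G k * k%:Z ^+ d - order_coef H k * k%:Z ^+ e)) => [t|].
  under eq_bigr do rewrite mulrBl -!mulrA -!exprD.
  rewrite sumrB -!num_genE ?eqGH ?subrr // ltnS ?leq_addl //.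
  by rewrite addnAC leq_addl.
by rewrite ltnS -addnA leq_addr.
Qed.

(** At k = |H| the right-hand coefficient of [shifted_order_coef] is nonzero,
    whereas the left-hand one would vanish if |G| < |H|. *)
Lemma shifted_card_le (gT hT : finGroupType) (G : {group gT}) (H : {group hT})
    (d e : nat) :
  (forall i, num_gen G (d + i) = num_gen H (e + i)) -> (#|H| <= #|G|)%N.
Proof.
move=> eqGH; rewrite leqNgt; apply/negP => /order_coef_gt coef0.
have /eqP := shifted_order_coef eqGH #|H|.
by rewrite coef0 order_coef_top mul0r mul1r eq_sym expf_eq0 eqz_nat eqn0Ngt cardG_gt0 andbF.
Qed.

(** The shifts are not assumed equal: comparing the coefficients at k = |G|
    gives |G|^d = |G|^e, hence d = e as soon as 1 < |G|. *)
Lemma shifted_num_gen (gT hT : finGroupType) (G : {group gT}) (H : {group hT})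
    (d e : nat) :
  (forall i, num_gen G (d + i) = num_gen H (e + i)) ->
  #|G| = #|H| /\ order_coef G =1 order_coef H.
Proof.
move=> eqGH; have eqHG i := esym (eqGH i).
have eqcard : #|G| = #|H|.
  by apply/eqP; rewrite eqn_leq (shifted_card_le eqGH) (shifted_card_le eqHG).
split=> // k; have := shifted_order_coef eqGH k.
have [-> | k0] := posnP k; first by rewrite !order_coef0.
have [leGk | ltkG] := leqP #|G| k.
  move: leGk; rewrite leq_eqVlt => /predU1P[<- _ | ltGk _].
    by rewrite {2}eqcard !order_coef_top.
  by rewrite !order_coef_gt -?eqcard.
have -> : d = e.
  have /eqP := shifted_order_coef eqGH #|G|.
  rewrite {3}eqcard !order_coef_top !mul1r -!natz -!natrX !natz eqz_nat.
  by rewrite eqn_exp2l ?(leq_ltn_trans k0) // => /eqP.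
by apply: mulIf; rewrite expf_eq0 eqz_nat (gtn_eqF k0) andbF.
Qed.

Lemma shifted_dirichlet_poly (R : realType) (gT hT : finGroupType)
    (G : {group gT}) (H : {group hT}) (d e : nat) :
  (forall i, num_gen G (d + i) = num_gen H (e + i)) ->
  forall s : complex R, dirichlet_poly G s = dirichlet_poly H s.
Proof.
case/shifted_num_gen => eqcard eqcoef s; rewrite /dirichlet_poly eqcard.
apply: eq_bigr => n _; congr (_%:~R / _); rewrite !dirichlet_coefE eqcard.
by apply: eq_bigr => k _.
Qed.

(** * The sequence of counts *)

Lemma num_gen_le (gT : finGroupType) (G : {group gT}) (b : nat) :
  (num_gen G b <= #|G| ^ b)%N.
Proof.
rewrite -card_tuples_in; apply/subset_leq_card/subsetP => x.
by rewrite !inE -sub_seq_group => /eqP ->.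
Qed.

(** Prepending any element of G to a generating tuple gives a generating
    tuple. *)
Lemma num_gen_step (gT : finGroupType) (G : {group gT}) (b : nat) :
  (#|G| * num_gen G b <= num_gen G b.+1)%N.
Proof.
rewrite -cardsX; have inj : injective (fun gx : gT * b.-tuple gT => [tuple of gx.1 :: gx.2]).
  by case=> g x [h y] /(congr1 val) /= [-> /val_inj ->].
rewrite -(card_imset _ inj); apply/subset_leq_card/subsetP => y.
case/imsetP => -[g x] /setXP[/= gG]; rewrite inE => /eqP xG ->.
rewrite inE eqEsubset sub_seq_group /= gG -sub_seq_group xG subxx -{1}xG genS //.
by apply/subsetP => z; rewrite !inE => ->; rewrite orbT.
Qed.

Lemma num_gen_exists (gT : finGroupType) (G : {group gT}) :
  exists b, (0 < b)%N && (0 < num_gen G b)%N.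
Proof.
exists (size (enum G)); rewrite -cardE cardG_gt0 /=; apply/card_gt0P.
rewrite cardE; exists (in_tuple (enum G)); rewrite inE /=.
apply/eqP; rewrite -[RHS]genGid; congr <<_>>%g.
by apply/setP => x; rewrite inE mem_enum.
Qed.

Lemma num_gen_trivial (gT : finGroupType) (G : {group gT}) (b : nat) :
  #|G| = 1%N -> (0 < num_gen G b)%N -> num_gen G b = 1%N.
Proof.
by move=> G1 pos; apply/eqP; rewrite eqn_leq pos andbT -(exp1n b) -G1 num_gen_le.
Qed.

Lemma num_gen_threshold (gT : finGroupType) (G : {group gT}) :
  exists2 d, (0 < d)%N & (forall i, 0 < num_gen G (d + i))%N /\
    (forall b, (0 < b)%N -> (0 < num_gen G b)%N -> exists i, b = d + i)%N.
Proof.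
case: (ex_minnP (num_gen_exists G)) => d /andP[d0 posd] mind.
exists d => //; split=> [|b b0 posb]; last first.
  by exists (b - d)%N; rewrite subnKC // mind // b0.
elim=> [|i IHi]; first by rewrite addn0.
by rewrite addnS (leq_trans _ (num_gen_step G _)) // muln_gt0 cardG_gt0.
Qed.

Lemma eq_increasing_range (f g : nat -> nat) :
    {homo f : i j / (i < j)%N} -> {homo g : i j / (i < j)%N} ->
    (forall i, exists j, f i = g j) -> (forall i, exists j, g i = f j) ->
  f =1 g.
Proof.
have le_step (f' g' : nat -> nat) i : {homo f' : i j / (i < j)%N} ->
    {homo g' : i j / (i < j)%N} -> (forall i, exists j, f' i = g' j) ->
    (forall j, (j < i)%N -> f' j = g' j) -> (g' i <= f' i)%N.
  move=> incf incg sub IH; have [j eqj] := sub i.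
  have [ltji | leij] := ltnP j i; first by have := incf _ _ ltji; rewrite IH // -eqj ltnn.
  by rewrite eqj; case: ltngtP leij => [/incg/ltnW | | ->].
move=> incf incg subfg subgf i; elim/ltn_ind: i => i IH.
apply/eqP; rewrite eqn_leq !le_step // => j /IH //.
Qed.

(** The shift comes from listing the common set of values in increasing order.
    The trivial group has the constant count 1, so it is separated first: the
    set of its values is {1}, and one constant sequence forces the other. *)
Lemma same_counts_shift (gT hT : finGroupType) (G : {group gT}) (H : {group hT}) :
  (forall b, (0 < b)%N -> (0 < num_gen G b)%N ->
     exists2 c, (0 < c)%N & num_gen G b = num_gen H c) ->
  (forall c, (0 < c)%N -> (0 < num_gen H c)%N ->
     exists2 b, (0 < b)%N & num_gen H c = num_gen G b) ->
  exists d e, forall i, num_gen G (d + i) = num_gen H (e + i).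
Proof.
move=> GH HG; have [d d0 [posG shiftG]] := num_gen_threshold G.
have [e e0 [posH shiftH]] := num_gen_threshold H; exists d, e.
have inc (rT : finGroupType) (K : {group rT}) k : (1 < #|K|)%N ->
    (forall i, 0 < num_gen K (k + i))%N ->
    {homo (fun i => num_gen K (k + i)) : i j / (i < j)%N}.
  move=> K1 pos; apply: homo_ltn => [|i]; first exact: ltn_trans.
  by rewrite addnS (leq_trans _ (num_gen_step K _)) // -[X in (X < _)%N]mul1n ltn_pmul2r.
have subG i : exists j, num_gen G (d + i) = num_gen H (e + j).
  have [|c c0 eqc] := GH (d + i)%N _ (posG i); first by rewrite addn_gt0 d0.
  by have [|j eqj] := shiftH c c0; [rewrite -eqc | exists j; rewrite -eqj].
have subH i : exists j, num_gen H (e + i) = num_gen G (d + j).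
  have [|c c0 eqc] := HG (e + i)%N _ (posH i); first by rewrite addn_gt0 e0.
  by have [|j eqj] := shiftG c c0; [rewrite -eqc | exists j; rewrite -eqj].
have [G1 | H1 | [G1 H1]] : [\/ #|G| = 1%N, #|H| = 1%N | (1 < #|G|)%N /\ (1 < #|H|)%N].
- have [leG | G1] := leqP #|G| 1.
    by constructor 1; apply/eqP; rewrite eqn_leq leG cardG_gt0.
  have [leH | H1] := leqP #|H| 1; last by constructor 3.
  by constructor 2; apply/eqP; rewrite eqn_leq leH cardG_gt0.
- have const j : num_gen H (e + j) = 1%N by have [k ->] := subH j; apply: num_gen_trivial.
  by move=> i; rewrite const; apply: num_gen_trivial.
- have const j : num_gen G (d + j) = 1%N by have [k ->] := subG j; apply: num_gen_trivial.
  by move=> i; rewrite const; apply/esym/num_gen_trivial.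
- exact: eq_increasing_range (inc _ _ _ G1 posG) (inc _ _ _ H1 posH) subG subH.
Qed.

(** * Stars in Lambda^* *)

(** With m = 1 either end of the edge can serve as centre, and m = 0 is a single
    vertex without a loop. *)
Definition star_graph (m : nat) (A : lgraph) : Prop :=
  exists2 c : A, #|A| = m.+1 & forall x y : A, adj x y = (x == c) (+) (y == c).

Lemma star_graph_iso (m : nat) (A B : lgraph) :
  graph_iso A B -> star_graph m A -> star_graph m B.
Proof.
case=> f bijf adjf [c cardA adjA]; exists (f c); first by rewrite -(bij_eq_card bijf).
case: (bijf) => g fK gK x y; rewrite -(gK x) -(gK y) adjf adjA.
by rewrite !(inj_eq (bij_inj bijf)).
Qed.

Lemma star_graph_of_labels (A : lgraph) (B : finType) (T : eqType)
    (f : A -> T) (g : B -> T) (c : A) (Q : {set B}) :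
    injective f -> injective g ->
    (forall x y, adj x y = (x == c) (+) (y == c)) ->
    (forall x, x != c -> exists2 y, y \in Q & f x = g y) ->
    (forall y, y \in Q -> exists2 x, x != c & f x = g y) ->
  star_graph #|Q| A.
Proof.
move=> injf injg adjA cQ Qc; exists c => //.
suff <- : #|predC1 c| = #|Q| by rewrite cardC1 prednK //; apply/card_gt0P; exists c.
rewrite -(size_image f) -(size_image g).
apply/perm_size/uniq_perm; rewrite ?map_inj_uniq ?enum_uniq // => z.
apply/imageP/imageP => [[x /cQ[y Qy fg] ->] | [y /Qc[x xc fg] ->]].
  by exists y.
by exists x.
Qed.

(** A vertex of a component is nested in four subtypes: component, non-isolated
    vertex, tuple of length a or b over G, bounded sequence. *)
Definition word (gT : finGroupType) (G : {group gT}) (i : Lambda_index G)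
    (v : Lambda_star i) : seq gT :=
  val (val (val (val v))).

(** The adjacency of the generating graph, read on bare sequences. *)
Definition joined (gT : finGroupType) (G : {group gT}) (a b : nat)
    (s t : seq gT) : bool :=
  ((size s == a) && (size t == b) || (size s == b) && (size t == a))
  && (<<[set:: s ++ t]>>%g == G :> {set gT}).

Lemma word_inj (gT : finGroupType) (G : {group gT}) (i : Lambda_index G) :
  injective (@word gT G i).
Proof. by move=> v w /val_inj/val_inj/val_inj/val_inj. Qed.

Lemma adj_word (gT : finGroupType) (G : {group gT}) (i : Lambda_index G)
  (v w : Lambda_star i) : adj v w = joined G (la i) (lb i) (word v) (word w).
Proof. by []. Qed.

Lemma size_word (gT : finGroupType) (G : {group gT}) (i : Lambda_index G)
  (v : Lambda_star i) : (size (word v) == la i) || (size (word v) == lb i).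
Proof. by case/andP: (valP (val (val v))). Qed.

Lemma word_in (gT : finGroupType) (G : {group gT}) (i : Lambda_index G)
  (v : Lambda_star i) : all [in G] (word v).
Proof. by case/andP: (valP (val (val v))). Qed.

Lemma lcomp_closed (gT : finGroupType) (G : {group gT}) (i : Lambda_index G)
    (x y : gen_graph_star G (la i) (lb i)) :
  x \in lcomp i -> adj x y -> y \in lcomp i.
Proof.
have /imsetP[z _ ->] := lcompP i; rewrite !inE => zx xy.
exact: connect_trans zx (connect1 xy).
Qed.

(** The components are closed under adjacency in the full generating graph, as
    both ends of an edge are non-isolated; this is what allows new vertices of a
    component to be made from old ones. *)
Lemma Lambda_neighbour (gT : finGroupType) (G : {group gT}) (i : Lambda_index G)
    (v : Lambda_star i) (s : seq gT) :
  joined G (la i) (lb i) (word v) s -> exists w : Lambda_star i, word w = s.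
Proof.
move=> vs; have /andP[sizes /eqP gens] := vs.
have sG : all [in G] s.
  rewrite -sub_seq_group -gens genS //.
  by apply/subsetP => z; rewrite !inE mem_cat => ->; rewrite orbT.
have size_s : (size s == la i) || (size s == lb i).
  by case/orP: sizes => /andP[_ ->]; rewrite ?orbT.
have le_s : (size s <= lb i)%N by case/orP: size_s => /eqP ->; rewrite ?la_le_lb.
have gvs : gen_vertex G (la i) (Bseq le_s) by rewrite /gen_vertex size_s.
pose u : gen_graph G (la i) (lb i) := Sub (Bseq le_s) gvs.
have adj_vu : adj (val (val v)) u by exact: vs.
have u_star : u \in [set x : gen_graph G (la i) (lb i) | ~~ isolated_vertex x].
  by rewrite inE; apply/forallPn; exists (val (val v)); rewrite adj_sym negbK.
pose u' : gen_graph_star G (la i) (lb i) := Sub u u_star.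
by exists (Sub u' (lcomp_closed (valP v) (adj_vu : adj (val v) u'))).
Qed.

Lemma Lambda_nonempty (gT : finGroupType) (G : {group gT}) (i : Lambda_index G) :
  (0 < #|Lambda_star i|)%N.
Proof.
have [x xi] : exists x, x \in lcomp i.
  by have /imsetP[x _ ->] := lcompP i; exists x; rewrite !inE connect0.
by apply/card_gt0P; exists (Sub x xi).
Qed.

Lemma Lambda_not_isolated (gT : finGroupType) (G : {group gT})
  (i : Lambda_index G) (v : Lambda_star i) : exists w, adj v w.
Proof.
have := valP (val v); rewrite inE => /forallPn[y]; rewrite negbK => vy.
have [w ws] := Lambda_neighbour (vy : joined G (la i) (lb i) (word v) (val (val y))).
by exists w; rewrite adj_word ws; exact: vy.
Qed.

(** Every vertex has a neighbour, and for a = 0 < b one of two neighbours is the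
    empty tuple; so each component contains the empty tuple, its other vertices
    generate G, and it contains all generating b-tuples. *)
Lemma Lambda_star0 (gT : finGroupType) (G : {group gT}) (i : Lambda_index G) :
  la i = 0%N -> (0 < lb i)%N -> star_graph (num_gen G (lb i)) (Lambda_star i).
Proof.
move=> a0 b0; have ltb : (0 == lb i)%N = false by rewrite eq_sym (gtn_eqF b0).
have [c wc] : exists c : Lambda_star i, word c = [::].
  have /card_gt0P[v _] := Lambda_nonempty i; have [w] := Lambda_not_isolated v.
  rewrite adj_word a0 => /andP[/orP[]/andP[sv sw] _]; last by exists w; apply/nilP.
  by exists v; apply/nilP.
have leaf x : x != c -> (size (word x) == lb i) && (<<[set:: word x]>>%g == G :> {set gT}).
  move=> xc; have xn : size (word x) == 0%N = false.
    apply: contraNF xc => /nilP wx; apply/eqP/word_inj; by rewrite wx wc.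
  have [y] := Lambda_not_isolated x.
  rewrite adj_word /joined a0 xn /= => /andP[/andP[-> /nilP ->]].
  by rewrite cats0.
have adjE (x y : Lambda_star i) : adj x y = (x == c) (+) (y == c).
  rewrite adj_word /joined a0; have [-> | /leaf/andP[/eqP xb /eqP xG]] := eqVneq x c.
    rewrite wc /=; have [-> | /leaf/andP[-> ->]] := eqVneq y c; last by [].
    by rewrite wc /= !ltb.
  rewrite xb eqxx (gtn_eqF b0) /=.
  have [-> | /leaf/andP[/eqP -> _]] := eqVneq y c; last by rewrite (gtn_eqF b0).
  by rewrite wc cats0 xG eqxx.
apply: (@star_graph_of_labels (Lambda_star i) ((lb i).-tuple gT) (seq gT)
  (@word _ _ i) val c (gen_tuples G (lb i)) (@word_inj _ _ i) val_inj adjE) => [x|t].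
  by move=> /leaf/andP[sx xG]; exists (Tuple sx); rewrite // inE.
rewrite inE => tG; have tb : size t = lb i by apply: size_tuple.
have [|x wx] := @Lambda_neighbour _ _ _ c t.
  by rewrite /joined wc a0 tb !eqxx.
exists x => //; apply: contraTneq b0 => xc.
by rewrite -tb -wx xc wc.
Qed.

Lemma star_of_num_gen (gT : finGroupType) (G : {group gT}) (b : nat) :
  (0 < b)%N -> (0 < num_gen G b)%N ->
  exists i : Lambda_index G, star_graph (num_gen G b) (Lambda_star i).
Proof.
move=> b0 /card_gt0P[t]; rewrite inE => tG.
have gc : gen_vertex G 0 (@Bseq b gT [::] (leq0n b)) by [].
have tb : size t = b by apply: size_tuple.
have gt : gen_vertex G 0 (Bseq (eq_leq tb)).
  by rewrite /gen_vertex [X in X == b]tb eqxx orbT -sub_seq_group (eqP tG) subxx.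
pose c : gen_graph G 0 b := Sub _ gc; pose u : gen_graph G 0 b := Sub _ gt.
have cu : adj c u by rewrite /= /gen_adj /= size_tuple eqxx.
have c_star : c \in [set x | ~~ isolated_vertex x].
  by rewrite inE; apply/forallPn; exists u; rewrite negbK.
pose c' : gen_graph_star G 0 b := Sub c c_star.
pose C := [set y in setT | connect (@adj (gen_graph_star G 0 b)) c' y].
have compC : C \in components (gen_graph_star G 0 b) by apply: imset_f.
exists (LambdaIndex (leq0n b) compC).
exact: (@Lambda_star0 _ _ (LambdaIndex (leq0n b) compC)).
Qed.

Lemma gen_mul_head (gT : finGroupType) (t s : seq gT) (g h : gT) :
  h \in <<[set:: t]>>%g ->
  <<[set:: t ++ (g * h)%g :: s]>>%g = <<[set:: t ++ g :: s]>>%g.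
Proof.
have half g' h' : h' \in <<[set:: t]>>%g ->
    <<[set:: t ++ (g' * h')%g :: s]>>%g \subset <<[set:: t ++ g' :: s]>>%g.
  move=> ht; rewrite sub_seq_group all_cat /=.
  have mem z : z \in t ++ g' :: s -> z \in <<[set:: t ++ g' :: s]>>%g.
    by move=> zt; rewrite mem_gen // inE.
  rewrite groupM /=; first 1 last.
  - by rewrite mem // mem_cat inE eqxx orbT.
  - apply: subsetP ht; rewrite genS //; apply/subsetP => z.
    by rewrite !inE mem_cat => ->.
  by apply/andP; split; apply/allP => z zt; rewrite mem // mem_cat ?inE zt ?orbT.
move=> ht; apply/eqP; rewrite eqEsubset half //= -{1}[g](mulgK h).
by rewrite half // groupV.
Qed.

Lemma card2_of_unique_neq (A : finType) (c l : A) :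
  l != c -> (forall x, x != c -> x = l) -> #|A| = 2.
Proof.
move=> lc uniq_l; rewrite -[RHS]/(true.+1) -lc eq_sym -cards2 -cardsT.
apply: eq_card => x; rewrite !inE; apply/esym/orP.
by have [-> | /uniq_l ->] := eqVneq x c; [left | right].
Qed.

(** The case 0 < a occurs only for the trivial group, where m = 1 is also the
    number of generating tuples of each length; otherwise a = 0 and the component
    is the star of [Lambda_star0]. *)
Lemma num_gen_of_star (gT : finGroupType) (G : {group gT}) (i : Lambda_index G) (m : nat) :
  (0 < m)%N -> star_graph m (Lambda_star i) -> exists2 b, (0 < b)%N & m = num_gen G b.
Proof.
move=> m0 [c cardA adjA].
have [l lc] : exists l : Lambda_star i, l != c.
  by apply/card_gt0P; rewrite cardC1 cardA.
have cl : adj c l by rewrite adjA eqxx (negbTE lc).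
have [a0 | a0] := posnP (la i).
  have [b0 | b0] := posnP (lb i); last first.
    by exists (lb i) => //; have [? + _] := Lambda_star0 a0 b0; rewrite cardA => -[].
  case/eqP: lc; apply: word_inj.
  have nil (v : Lambda_star i) : word v = [::].
    by apply/nilP; have := size_word v; rewrite a0 b0 orbb.
  by rewrite !nil.
have size_gt0 (v : Lambda_star i) : (0 < size (word v))%N.
  by case/orP: (size_word v) => /eqP ->; rewrite // (leq_trans a0 (la_le_lb i)).
(* Multiplying the first entry of the centre by an entry h of a leaf x gives
   a neighbour of x, which must be the centre again; so h = 1. *)
have leaf_trivial (x : Lambda_star i) : x != c -> all (pred1 1%g) (word x).
  move=> xc; have cx : adj c x by rewrite adjA eqxx (negbTE xc).
  apply/allP => h hx /=; case wc: (word c) (size_gt0 c) => [//|g s] _.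
  have xs : joined G (la i) (lb i) (word x) (g * h :: s)%g.
    by move: cx; rewrite adj_sym adj_word /joined wc gen_mul_head // mem_gen ?inE.
  have [w ww] := Lambda_neighbour xs.
  have : adj x w by rewrite adj_word ww.
  rewrite adjA (negbTE xc) /= => /eqP eqwc.
  by move: ww; rewrite eqwc wc => -[gh]; apply/eqP/(mulgI g); rewrite mulg1.
have gen_c : <<[set:: word c]>>%g = G :> {set gT}.
  move: cl; rewrite adj_word => /andP[_ /eqP <-].
  apply/eqP; rewrite eqEsubset !sub_seq_group all_cat; apply/and3P; split.
  - by apply/allP => z zc; rewrite mem_gen // inE mem_cat zc.
  - by apply/allP => z zc; rewrite mem_gen // inE.
  - by apply/allP => z /(allP (leaf_trivial l lc))/eqP -> /=; apply: group1.
have joined_c s : size s = size (word l) -> all [in G] s ->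
    joined G (la i) (lb i) (word c) s.
  move=> sl sG; move: cl; rewrite adj_word /joined sl => /andP[-> _] /=.
  rewrite eqEsubset sub_seq_group all_cat word_in sG -{1}gen_c genS //.
  by apply/subsetP => z; rewrite !inE mem_cat => ->.
(* Otherwise the centre, which generates G, would carry a loop. *)
have size_neq : size (word c) != size (word l).
  apply/eqP => cl_size; have : adj c c by rewrite adj_word joined_c // word_in.
  by rewrite adjA addbb.
have leaf_word (x : Lambda_star i) : x != c -> word x = nseq (size (word l)) 1%g.
  move=> xc; have <- : size (word x) = size (word l); last exact/all_pred1P/leaf_trivial.
  have : adj c x by rewrite adjA eqxx (negbTE xc).
  move: cl; rewrite !adj_word => /andP[cl_sizes _] /andP[cx_sizes _].
  case/orP: cl_sizes => /andP[/eqP sc /eqP sl];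
    by case/orP: cx_sizes => /andP[/eqP sc' /eqP sx]; rewrite sx sl -?sc -?sc'.
(* The centre is adjacent to the constant tuple at each z of G, so this tuple
   is a leaf and z = 1. *)
have G1 : #|G| = 1%N.
  apply/eqP; rewrite -trivg_card1 -subG1; apply/subsetP => z zG; rewrite inE.
  have [|w ww] := Lambda_neighbour (joined_c (nseq (size (word l)) z) (size_nseq _ _) _).
    by rewrite all_nseq /= zG orbT.
  have wc : w != c by apply: contraNneq size_neq => wc; rewrite -wc ww size_nseq.
  move: ww; rewrite (leaf_word w wc); case: (size (word l)) (size_gt0 l) => // n _.
  by move/(congr1 (head z)) => /= <-.
have [d d0 [posG _]] := num_gen_threshold G; exists (d + 0)%N; first by rewrite addn0.
have [] : m.+1 = 2%N; last by move=> ->; rewrite num_gen_trivial.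
rewrite -cardA (@card2_of_unique_neq (Lambda_star i) c l lc) // => x xc.
by apply: word_inj; rewrite (leaf_word x xc) -(leaf_word l lc).
Qed.

Lemma star_counts_transfer (gT hT : finGroupType) (G : {group gT}) (H : {group hT})
    (f : Lambda_index G -> Lambda_index H) :
  (forall i, graph_iso (Lambda_star i) (Lambda_star (f i))) ->
  forall b, (0 < b)%N -> (0 < num_gen G b)%N ->
    exists2 c, (0 < c)%N & num_gen G b = num_gen H c.
Proof.
move=> isof b b0 posb; have [i /(star_graph_iso (isof i))] := star_of_num_gen b0 posb.
exact: num_gen_of_star.
Qed.

Lemma graph_iso_sym (A B : lgraph) : graph_iso A B -> graph_iso B A.
Proof.
by case=> f [g fK gK] adjf; exists g => [|x y]; [exists f | rewrite -adjf !gK].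
Qed.

Theorem theorem5p13 (R : realType) (gT hT : finGroupType)
    (G : {group gT}) (H : {group hT}) :
  same_Lambda_star G H ->
  forall s : complex R, dirichlet_poly G s = dirichlet_poly H s.
Proof.
case=> f [g fK gK] isof.
have isog j : graph_iso (Lambda_star j) (Lambda_star (g j)).
  by apply: graph_iso_sym; rewrite -{2}[j]gK.
have [d [e shift]] :=
  same_counts_shift (star_counts_transfer isof) (star_counts_transfer isog).
exact: shifted_dirichlet_poly shift.
Qed.
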